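(* Let $n>2$ be an integer, let $\widetilde{\mathfrak C}_n$ be the set of labelled $n$-regular boundary graphs, and let $\pi_n:\widetilde{\mathfrak C}_n\to\mathfrak C$ be the restriction to $\widetilde{\mathfrak C}_n$ of the map $\pi$ which removes all virtual edges by contraction and deletion moves. (i) If $n$ is odd, then $\pi_n:\widetilde{\mathfrak C}_n\to\mathfrak C$ is surjective. (ii) If $n$ is even, then $\pi_n$ takes values in $\mathfrak C_{even}$ and $\pi_n:\widetilde{\mathfrak C}_n\to\mathfrak C_{even}$ is surjective, where $\mathfrak C_{even}\subset\mathfrak C$ is the subset of boundary graphs with only even-valent vertices.
   Context: All graphs are finite and considered up to isomorphism. Boundary graph: a pair $\mathfrak{c}=(\overline{\mathcal V},\overline{\mathcal E})$, $\overline{\mathcal V}$ a non-empty vertex set, $\overline{\mathcal E}$ a multiset of unordered pairs of elements of $\overline{\mathcal V}$ (loops and multi-edges allowed), such that the graph is connected. $\mathfrak{C}$ denotes the set of boundary graphs. The valence of a vertex is the number of edge ends incident at it (a loop counts twice). Labelled boundary graph: a boundary graph together with a label from $\{real, virtual\}$ for each edge; $\widetilde{\mathfrak C}$ is the set of these. It is $n$-regular if every vertex has valence $n$ (counting real and virtual edges). Reduction moves on a labelled boundary graph: a contraction move applies to a virtual edge $(\bar v_1\bar v_2)$ between two distinct vertices; it removes this edge and identifies $\bar v_1$ with $\bar v_2$. A deletion move applies to a virtual loop $(\bar v\bar v)$ and removes it. The map $\pi:\widetilde{\mathfrak C}\to\mathfrak C$ sends a labelled boundary graph to the boundary graph obtained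 by applying contraction and deletion moves until no virtual edge is left (the result is independent of the chosen sequence of moves), whose edges are then the original real edges with labels forgotten. *)

(* Defs.v *)
From HB Require Import structures.
From mathcomp Require Import all_boot.
From Stdlib Require Import Relation_Operators.

Set Implicit Arguments.
Unset Strict Implicit.
Unset Printing Implicit Defensive.

(* Edges are pairs whose order carries no information: adjacency and valence
   are symmetric in the two ends, and [isomorphic] compares the associated
   unordered pairs [set x; y] (equal to [set x] for a loop at x).  Likewise the
   sequence of edges is only ever considered up to permutation. *)

Section EdgeSequences.

Variable V : finType.
Implicit Types (s : seq (V * V)) (v : V).

Definition adj s : rel V := [rel x y | ((x, y) \in s) || ((y, x) \in s)].

Definition connected s : bool := [forall x, forall y, connect (adj s) x y].

(* Number of edge ends at v: a loop (v, v) contributes 2. *)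
Definition valence s v : nat := \sum_(e <- s) ((e.1 == v) + (e.2 == v)).

End EdgeSequences.

Record boundary_graph := BoundaryGraph {
  vertex : finType;
  edges : seq (vertex * vertex);
  vertex_gt0 : 0 < #|vertex|;
  edges_connected : connected edges
}.

Definition isomorphic (c d : boundary_graph) : Prop :=
  exists f : vertex c -> vertex d,
    bijective f /\
    perm_eq [seq [set f e.1; f e.2] | e <- edges c]
            [seq [set e.1; e.2] | e <- edges d].

Definition regular (n : nat) (c : boundary_graph) : Prop :=
  forall v : vertex c, valence (edges c) v = n.

Definition even_valent (c : boundary_graph) : Prop :=
  forall v : vertex c, ~~ odd (valence (edges c) v).

Variant label := Real | Virtual.

Definition is_real (l : label) : bool := if l is Real then true else false.

Fact label_eqP : eq_axiom (fun l m : label => is_real l == is_real m).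
Proof. by case=> -[]; constructor. Qed.

HB.instance Definition _ := hasDecEq.Build label label_eqP.

Definition unlabel (V : finType) (s : seq (V * V * label)) : seq (V * V) :=
  [seq e.1 | e <- s].

Record labelled_graph := LabelledGraph {
  lvertex : finType;
  ledges : seq (lvertex * lvertex * label);
  lvertex_gt0 : 0 < #|lvertex|;
  ledges_connected : connected (unlabel ledges)
}.

Definition forget (G : labelled_graph) : boundary_graph :=
  BoundaryGraph (lvertex_gt0 G) (ledges_connected G).

Definition lregular (n : nat) (G : labelled_graph) : Prop :=
  regular n (forget G).

Lemma connect_homo (T U : finType) (e : rel T) (e' : rel U) (f : T -> U) :
  (forall x y, e x y -> connect e' (f x) (f y)) ->
  forall x y, connect e x y -> connect e' (f x) (f y).
Proof.
move=> fe x y /connectP[p].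
elim: p x => [|z p IHp] x /=; first by move=> _ ->; apply: connect0.
by case/andP=> /fe xz zp /(IHp _ zp); apply: connect_trans.
Qed.

Lemma adj_sym (V : finType) (s : seq (V * V)) : symmetric (adj s).
Proof. by move=> x y; rewrite /adj /= orbC. Qed.

Lemma connect_adj_sym (V : finType) (s : seq (V * V)) :
  symmetric (connect (adj s)).
Proof. exact/sym_connect_sym/adj_sym. Qed.

Section Contraction.

Variables (G : labelled_graph) (x y : lvertex G) (xy : x != y).
Hypothesis exy : (x, y, Virtual) \in ledges G.

(* The identification of x and y is realized by removing y from the vertex
   type and replacing it by x at every edge end. *)
Definition contract_vertex : finType := {z : lvertex G | z != y}.

Definition contract_proj (z : lvertex G) : contract_vertex :=
  insubd (Sub x xy : contract_vertex) z.

Definition contract_edges : seq (contract_vertex * contract_vertex * label) :=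
  [seq (contract_proj e.1.1, contract_proj e.1.2, e.2)
     | e <- rem (x, y, Virtual) (ledges G)].

Lemma contract_gt0 : 0 < #|contract_vertex|.
Proof. by apply/card_gt0P; exists (Sub x xy). Qed.

Lemma val_contract_proj z : val (contract_proj z) = if z == y then x else z.
Proof. by rewrite /contract_proj val_insubd; case: eqP. Qed.

Lemma contract_projK (z : contract_vertex) : contract_proj (val z) = z.
Proof. by apply: val_inj; rewrite val_contract_proj (negPf (valP z)). Qed.

Lemma contract_proj_eq : contract_proj x = contract_proj y.
Proof. by apply: val_inj; rewrite !val_contract_proj eqxx if_same. Qed.

Lemma contract_connected : connected (unlabel contract_edges).
Proof.
apply/forallP=> a; apply/forallP=> b.
rewrite -(contract_projK a) -(contract_projK b).
have : connect (adj (unlabel (ledges G))) (val a) (val b).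
  by have /forallP/(_ (val a))/forallP := ledges_connected G; apply.
apply: connect_homo => a' b'.
have aux c d : (c, d) \in unlabel (ledges G) ->
    connect (adj (unlabel contract_edges)) (contract_proj c) (contract_proj d).
  case/mapP=> -[[c' d'] l] el /= [-> ->] {c d}.
  rewrite (perm_mem (perm_to_rem exy)) inE in el.
  case/predU1P: el => [[-> -> _]|el]; first by rewrite contract_proj_eq connect0.
  apply: connect1; apply/orP; left.
  by apply/mapP; exists (contract_proj c', contract_proj d', l) => //; apply: map_f el.
by case/orP=> /aux //; rewrite connect_adj_sym.
Qed.

Definition contract : labelled_graph :=
  LabelledGraph contract_gt0 contract_connected.

End Contraction.

Section Deletion.

Variables (G : labelled_graph) (x : lvertex G).
Hypothesis exx : (x, x, Virtual) \in ledges G.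

Definition delete_edges := rem (x, x, Virtual) (ledges G).

Lemma delete_connected : connected (unlabel delete_edges).
Proof.
apply/forallP=> a; apply/forallP=> b.
have : connect (adj (unlabel (ledges G))) a b.
  by have /forallP/(_ a)/forallP := ledges_connected G; apply.
apply: (@connect_homo _ _ _ _ id) => a' b'.
have aux c d : (c, d) \in unlabel (ledges G) ->
    connect (adj (unlabel delete_edges)) c d.
  case/mapP=> -[[c' d'] l] el /= [-> ->] {c d}.
  rewrite (perm_mem (perm_to_rem exx)) inE in el.
  case/predU1P: el => [[-> -> _]|el]; first exact: connect0.
  apply: connect1; apply/orP; left.
  by apply/mapP; exists (c', d', l).
by case/orP=> /aux //; rewrite connect_adj_sym.
Qed.

Definition delete : labelled_graph :=
  LabelledGraph (lvertex_gt0 G) delete_connected.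

End Deletion.

Inductive move : labelled_graph -> labelled_graph -> Prop :=
| ContractionMove (G : labelled_graph) (x y : lvertex G) (xy : x != y)
    (e : (x, y, Virtual) \in ledges G) : move G (contract xy e)
| DeletionMove (G : labelled_graph) (x : lvertex G)
    (e : (x, x, Virtual) \in ledges G) : move G (delete e).

Definition all_real (G : labelled_graph) : bool :=
  all (fun e => is_real e.2) (ledges G).

Definition full_reduction (G H : labelled_graph) : Prop :=
  clos_refl_trans_1n labelled_graph move G H /\ all_real H.

Lemma full_reduction_exists (G : labelled_graph) :
  {H : labelled_graph | full_reduction G H}.
Proof.
have [n] := ubnP (size (ledges G)); elim: n G => // n IHn G leGn.
case: (pickP (fun p => (p, Virtual) \in ledges G)) => [[x y] e | noV]; last first.
  exists G; split; first exact: rt1n_refl.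
  apply/allP=> -[p [|]] //= pE; by have := noV p; rewrite /= pE.
have ltE : size (rem (x, y, Virtual) (ledges G)) < n.
  by rewrite size_rem //; case: (ledges G) e leGn.
have [exy | xy] := eqVneq x y.
  subst y; have [//|H [GH rH]] := IHn (delete e).
  by exists H; split=> //; apply: rt1n_trans GH; apply: DeletionMove.
have [|H [GH rH]] := IHn (contract xy e); first by rewrite /= size_map.
by exists H; split=> //; apply: rt1n_trans GH; apply: ContractionMove.
Qed.

Definition pi_map (G : labelled_graph) : boundary_graph :=
  forget (sval (full_reduction_exists G)).

Lemma pi_map_spec (G : labelled_graph) :
  exists2 H, full_reduction G H & pi_map G = forget H.
Proof. by exists (sval (full_reduction_exists G)) => //; apply: svalP. Qed.

Section Independence.

Definition vedges (G : labelled_graph) : seq (lvertex G * lvertex G) :=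
  [seq e.1 | e <- ledges G & ~~ is_real e.2].

Definition redges (G : labelled_graph) : seq (lvertex G * lvertex G) :=
  [seq e.1 | e <- ledges G & is_real e.2].

Definition collapse (G H : labelled_graph) (f : lvertex G -> lvertex H) :=
  [/\ forall z, exists a, f a = z,
      forall a b, connect (adj (vedges H)) (f a) (f b)
                  = connect (adj (vedges G)) a b
    & perm_eq (redges H) [seq (f e.1, f e.2) | e <- redges G]].

Lemma mem_vedges (G : labelled_graph) p :
  (p \in vedges G) = ((p, Virtual) \in ledges G).
Proof.
apply/mapP/idP => [[[q [|]]]|pE]; rewrite ?mem_filter //=; first by move=> qE ->.
by exists (p, Virtual); rewrite // mem_filter.
Qed.

Lemma move_collapse (G H : labelled_graph) :
  move G H -> exists f : lvertex G -> lvertex H, collapse f.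
Proof.
case=> {G H} [G x y xy e | G x e].
- exists (contract_proj xy); split.
  + by move=> z; exists (val z); apply: contract_projK.
  + have homoG : {homo contract_proj xy : c d / connect (adj (vedges G)) c d >->
        connect (adj (vedges (contract xy e))) c d}.
      apply: connect_homo => c d.
      have aux c' d' : (c', d') \in vedges G ->
         connect (adj (vedges (contract xy e)))
            (contract_proj xy c') (contract_proj xy d').
        rewrite mem_vedges (perm_mem (perm_to_rem e)) inE.
        case/predU1P=> [[-> ->]|el]; first by rewrite contract_proj_eq connect0.
        apply/connect1/orP; left; rewrite mem_vedges.
        exact: (map_f (fun e =>
          (contract_proj xy e.1.1, contract_proj xy e.1.2, e.2)) el).
      by case/orP=> /aux //; rewrite connect_adj_sym.
    have Vproj c : connect (adj (vedges G)) (val (contract_proj xy c)) c.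
      rewrite val_contract_proj; case: eqP => [->|_]; last exact: connect0.
      by apply/connect1/orP; left; rewrite mem_vedges.
    move=> a b; apply/idP/idP => [|/homoG //].
    move=> ab; apply: connect_trans (Vproj b).
    rewrite connect_adj_sym; apply: connect_trans (Vproj a).
    rewrite connect_adj_sym.
    move: ab; apply: (@connect_homo _ _ _ _ val) => c d.
    have aux c' d' : (c', d') \in vedges (contract xy e) ->
       connect (adj (vedges G)) (val c') (val d').
      rewrite mem_vedges => /mapP[[[c0 d0] l] /mem_rem el /= [-> -> lV]].
      apply: connect_trans (Vproj c0) _.
      rewrite connect_adj_sym; apply: connect_trans (Vproj d0) _.
      rewrite connect_adj_sym; apply/connect1/orP; left.
      by rewrite mem_vedges lV.
    by case/orP=> /aux //; rewrite connect_adj_sym.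
  + have /(perm_filter (fun e => is_real e.2)) := perm_to_rem e.
    move=> /= /(perm_map fst).
    move/(perm_map (fun p => (contract_proj xy p.1, contract_proj xy p.2))).
    rewrite perm_sym; apply: perm_trans.
    by rewrite /redges filter_map -!map_comp.
- exists id; split; first by move=> z; exists z.
  + move=> a b; apply/idP/idP; apply: (@connect_homo _ _ _ _ id) => c d cd.
      have aux p : p \in vedges (delete e) -> p \in vedges G.
        move=> el; apply: (etrans (@mem_vedges G p)).
        exact: mem_rem (etrans (esym (@mem_vedges (delete e) p)) el).
      by apply: connect1; case/orP: cd => /aux el; apply/orP; [left | right].
    have aux c' d' : (c', d') \in vedges G ->
       connect (adj (vedges (delete e))) c' d'.
      rewrite mem_vedges (perm_mem (perm_to_rem e)) inE.
      case/predU1P=> [[-> ->]|el]; first exact: connect0.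
      by apply/connect1/orP; left; rewrite mem_vedges.
    by case/orP: cd => /aux //; rewrite connect_adj_sym.
  + have /(perm_filter (fun e => is_real e.2)) := perm_to_rem e.
    rewrite /= => /(perm_map fst); rewrite perm_sym => /perm_trans; apply.
    by rewrite (eq_map (g := id)) ?map_id // => -[].
Qed.

Lemma full_reduction_collapse (G H : labelled_graph) :
  full_reduction G H -> exists f : lvertex G -> lvertex H, collapse f.
Proof.
case=> GH _; elim: GH => {G H} [G | G H K /move_collapse[f [f1 f2 f3]] _ [g [g1 g2 g3]]].
  exists id; split=> //; first by move=> z; exists z.
  by rewrite (eq_map (g := id)) ?map_id // => -[].
exists (g \o f); split.
- by move=> z; have [a <-] := g1 z; have [b <-] := f1 a; exists b.
- by move=> a b; rewrite /= g2 f2.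
apply: perm_trans g3 _.
by have := perm_map (fun e => (g e.1, g e.2)) f3; rewrite -[X in perm_eq _ X]map_comp.
Qed.

(* The result of a full reduction does not depend on the sequence of moves. *)
Lemma full_reduction_unique (G H K : labelled_graph) :
  full_reduction G H -> full_reduction G K -> isomorphic (forget H) (forget K).
Proof.
move=> GH GK.
have [f [f1 f2 f3]] := full_reduction_collapse GH.
have [g [g1 g2 g3]] := full_reduction_collapse GK.
have noV L : all_real L -> connect (adj (vedges L)) =2 (fun a b => a == b).
  move=> /allP rL a b; apply/idP/eqP => [|->]; last exact: connect0.
  case/connectP=> -[|c p] //= /andP[ac _] _.
  by move: ac; rewrite /adj /= !mem_vedges => /orP[] /rL.
have redE L : all_real L -> redges L = unlabel (ledges L).
  by rewrite /all_real /redges => /all_filterP ->.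
have {}f2 a b : (f a == f b) = connect (adj (vedges G)) a b.
  by rewrite -f2 noV //; case: GH.
have {}g2 a b : (g a == g b) = connect (adj (vedges G)) a b.
  by rewrite -g2 noV //; case: GK.
have fg a b : (f a == f b) = (g a == g b) by rewrite f2 g2.
have inv (L : labelled_graph) (h : lvertex G -> lvertex L) :
    (forall z, exists a, h a = z) -> {h' | cancel h' h}.
  move=> h1; have h1' z : exists a, h a == z by have [a <-] := h1 z; exists a.
  by exists (fun z => xchoose (h1' z)) => z; apply/eqP/(xchooseP (h1' z)).
have [f' ff'] := inv _ _ f1; have [g' gg'] := inv _ _ g1.
have gf a : g (f' (f a)) = g a by apply/eqP; rewrite -fg ff'.
have fg' a : f (g' (g a)) = f a by apply/eqP; rewrite fg gg'.
exists (g \o f'); split.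
  exists (f \o g') => z /=; first by rewrite fg' ff'.
  by rewrite gf gg'.
rewrite /= -(redE _ (proj2 GH)) -(redE _ (proj2 GK)).
have := perm_map (fun e => [set (g \o f') e.1; (g \o f') e.2]) f3.
move/perm_trans; apply.
have := perm_map (fun e => [set e.1; e.2]) g3.
rewrite perm_sym; apply: perm_trans.
rewrite -[X in perm_eq X _]map_comp -[X in perm_eq _ X]map_comp.
by under eq_map => e do rewrite /= !gf.
Qed.

End Independence.

(* Main.v *)
(* For surjectivity, blow up every vertex v of c into a fibre consisting of the
   edge ends at v and two more points, so that the real edges, together with one
   virtual edge between the two additional points of each fibre, form a perfect
   matching.  A virtual cycle through each fibre, repeated k > 0 times, makes the
   fibres connected and every valence equal to 2k + 1, which settles odd n.  When
   all valences of c are even, so are the sizes of the fibres, and a virtual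
   perfect matching of each fibre brings the valence to 2k + 2.

   Conversely, the valence of a vertex of pi G is the sum of the valences over
   its fibre in G, minus twice the number of virtual edges in that fibre. *)
Require Import Defs.
From mathcomp Require Import all_boot.
From mathcomp Require Import zify.

Set Implicit Arguments.
Unset Strict Implicit.
Unset Printing Implicit Defensive.

(** * Valence under sums, maps and loops *)

Section Valence.

Variable V : finType.
Implicit Types (s t : seq (V * V)) (v : V).

Lemma valence_nil v : valence [::] v = 0.
Proof. by rewrite /valence big_nil. Qed.

Lemma valence_cons e s v :
  valence (e :: s) v = (e.1 == v) + (e.2 == v) + valence s v.
Proof. by rewrite /valence big_cons. Qed.

Lemma valence_cat s t v : valence (s ++ t) v = valence s v + valence t v.
Proof. by rewrite /valence big_cat. Qed.

Lemma valence_perm s t v : perm_eq s t -> valence s v = valence t v.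
Proof. exact: perm_big. Qed.

Lemma valence_flatten (ss : seq (seq (V * V))) v :
  valence (flatten ss) v = \sum_(s <- ss) valence s v.
Proof.
elim: ss => [|s ss IH] /=; first by rewrite valence_nil big_nil.
by rewrite valence_cat big_cons IH.
Qed.

(** Each edge end at [v] in the image comes from exactly one end lying over [v]. *)
Lemma valence_map (W : finType) (f : W -> V) (s : seq (W * W)) v :
  valence [seq (f e.1, f e.2) | e <- s] v = \sum_(w | f w == v) valence s w.
Proof.
rewrite /valence big_map exchange_big /=; apply: eq_bigr => e _.
have ends w : (f w == v : nat) = \sum_(w' | f w' == v) (w == w').
  rewrite big_mkcond (bigD1 w) //= eqxx big1 => [|w' /negPf w'w].
    by case: (f w == v).
  by rewrite [w == _]eq_sym w'w; case: ifP.
by rewrite big_split /= -!ends.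
Qed.

Lemma valence_image (T : finType) (h : T -> V * V) v :
  valence [seq h x | x <- enum T] v = \sum_x (((h x).1 == v) + ((h x).2 == v)).
Proof. by rewrite /valence big_map big_enum. Qed.

(** Virtual edges become loops once collapsed, so this removes them from parity counts. *)
Lemma odd_valence_loops s v : all (fun e => e.1 == e.2) s -> ~~ odd (valence s v).
Proof.
elim: s => [|e s IH] /=; first by rewrite valence_nil.
by case/andP=> /eqP eqe /IH; rewrite valence_cons eqe addnn oddD odd_double.
Qed.

Lemma sub_connect_adj s t x y :
  {subset s <= t} -> connect (adj s) x y -> connect (adj t) x y.
Proof.
move=> st; apply: connect_sub => a b ab; apply: connect1.
by case/orP: ab => /st ab; apply/orP; [left | right].
Qed.

End Valence.

(** * Cycles and matchings along a sequence of points *)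

Section SequenceGraphs.

Variable W : finType.
Implicit Types (p e : seq W) (w x z : W).

Fixpoint walk_edges x p z : seq (W * W) :=
  if p is y :: p' then (x, y) :: walk_edges y p' z else [:: (x, z)].

(** A one-element sequence yields a loop, so every entry contributes valence 2 whatever the
    length. *)
Definition cycle_edges e := if e is x :: p then walk_edges x p x else [::].

(** In odd length the last entry stays unmatched, hence the parity condition in
    [valence_matching]. *)
Fixpoint matching_edges e : seq (W * W) :=
  if e is x :: y :: e' then (x, y) :: matching_edges e' else [::].

Lemma valence_walk x p z w :
  valence (walk_edges x p z) w = (x == w) + (count_mem w p).*2 + (z == w).
Proof.
elim: p x => [|y p IH] x /=; rewrite valence_cons /= ?valence_nil ?addn0 // IH.
by rewrite doubleD -[(y == w).*2]addnn !addnA.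
Qed.

Lemma valence_cycle e w : valence (cycle_edges e) w = (count_mem w e).*2.
Proof. by case: e => [|x p] /=; rewrite ?valence_nil // valence_walk addnAC addnn doubleD. Qed.

Lemma valence_matching e w :
  ~~ odd (size e) -> valence (matching_edges e) w = count_mem w e.
Proof.
have [n] := ubnP (size e); elim: n e => // n IH [|x [|y e]] //= len.
  by rewrite valence_nil.
by rewrite negbK valence_cons /= => /IH ->; rewrite ?addnA //; lia.
Qed.

Lemma walk_edgesS x p z a :
  a \in walk_edges x p z -> a.1 \in x :: p /\ a.2 \in rcons p z.
Proof.
elim: p x => [|y p IH] x /=; first by rewrite inE => /eqP->; rewrite !inE /=.
rewrite inE => /predU1P[->|/IH [a1 a2]]; rewrite !inE /= ?eqxx //.
by rewrite -in_cons a1 a2 !orbT.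
Qed.

Lemma cycle_edgesS e a : a \in cycle_edges e -> a.1 \in e /\ a.2 \in e.
Proof. by case: e => //= x p /walk_edgesS; rewrite mem_rcons. Qed.

Lemma matching_edgesS e a : a \in matching_edges e -> a.1 \in e /\ a.2 \in e.
Proof.
have [n] := ubnP (size e); elim: n e => // n IH [|x [|y e]] //= len.
rewrite inE => /predU1P[->|/IH{IH}IH]; first by rewrite !inE /= !eqxx orbT.
by have [|a1 a2] := IH; [lia | rewrite !inE a1 a2 !orbT].
Qed.

Lemma connect_walk x p z w :
  w \in x :: p -> connect (adj (walk_edges x p z)) x w.
Proof.
elim: p x => [|y p IH] x; first by rewrite inE => /eqP->.
rewrite inE => /predU1P[->|/IH yw] //; apply: (@connect_trans _ _ y).
  by apply/connect1/orP; left; rewrite mem_head.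
by apply: sub_connect_adj yw => a aP; rewrite inE aP orbT.
Qed.

Lemma connect_cycle e x y :
  x \in e -> y \in e -> connect (adj (cycle_edges e)) x y.
Proof.
case: e => //= z p xe ye; apply: (@connect_trans _ _ z).
  by rewrite connect_adj_sym connect_walk.
exact: connect_walk.
Qed.

End SequenceGraphs.

(** * The reduced graph as a quotient by virtual components *)

Lemma redges_all_real (G : labelled_graph) :
  all_real G -> redges G = unlabel (ledges G).
Proof. by rewrite /all_real /redges => /all_filterP ->. Qed.

Lemma connect_all_real (G : labelled_graph) a b :
  all_real G -> connect (adj (vedges G)) a b = (a == b).
Proof.
move=> /allP rG; apply/idP/eqP => [|->]; last exact: connect0.
case/connectP=> -[|c p] //= /andP[ac _] _.
by move: ac; rewrite /adj /= !mem_vedges => /orP[] /rG.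
Qed.

(** All that is used about [pi_map] from here on: it is the quotient of [G] by its virtual
    components, carrying the real edges. *)
Lemma pi_map_collapse (G : labelled_graph) :
  exists f : lvertex G -> vertex (pi_map G),
    [/\ forall z, exists a, f a = z,
        forall a b, (f a == f b) = connect (adj (vedges G)) a b
      & perm_eq (edges (pi_map G)) [seq (f e.1, f e.2) | e <- redges G]].
Proof.
have [H GH ->] := pi_map_spec G; have [f [f1 f2 f3]] := full_reduction_collapse GH.
case: GH => _ rH; exists f; split=> // [a b|]; first by rewrite -f2 connect_all_real.
by rewrite /= -redges_all_real.
Qed.

Lemma perm_redges_vedges (G : labelled_graph) :
  perm_eq (unlabel (ledges G)) (redges G ++ vedges G).
Proof.
rewrite /redges /vedges -map_cat perm_sym perm_map //.
exact/permPl/perm_filterC.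
Qed.

Lemma even_valent_pi_map (n : nat) (G : labelled_graph) :
  ~~ odd n -> lregular n G -> even_valent (pi_map G).
Proof.
move=> en rG; have [f [_ f2 f3]] := pi_map_collapse G; move=> z.
(* A virtual edge joins points of one fibre of [f], so its image is a loop. *)
have loops : ~~ odd (valence [seq (f e.1, f e.2) | e <- vedges G] z).
  apply: odd_valence_loops; apply/allP=> _ /mapP[[a b] ab ->] /=.
  by rewrite f2 connect1 //; apply/orP; left.
(* The valences over the fibre of [z] sum to [n] times its size. *)
have total : ~~ odd (valence [seq (f e.1, f e.2) | e <- unlabel (ledges G)] z).
  rewrite valence_map (eq_bigr (fun=> n)) => [|w _]; last exact: rG.
  by rewrite sum_nat_const oddM (negPf en) andbF.
rewrite (valence_perm _ f3); move: total.
rewrite (valence_perm z (perm_map _ (perm_redges_vedges G))) map_cat valence_cat.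
by rewrite oddD (negPf loops) addbF.
Qed.

(** With [r] real and [u] virtual, [pi_map] collapses exactly the fibres of [f], so the quotient is
    [c]. The section [g] serves to lift paths of [c]. *)
Lemma pi_map_blowup (n : nat) (c : boundary_graph) (W : finType)
    (f : W -> vertex c) (g : vertex c -> W) (r u : seq (W * W)) :
  cancel g f ->
  (forall a b, connect (adj u) a b = (f a == f b)) ->
  [seq (f e.1, f e.2) | e <- r] = edges c ->
  (forall w, valence (r ++ u) w = n) ->
  exists2 G, lregular n G & isomorphic (pi_map G) c.
Proof.
move=> gK uP rE val_n.
pose l := [seq (e, Real) | e <- r] ++ [seq (e, Virtual) | e <- u].
have lE : unlabel l = r ++ u.
  by rewrite /unlabel map_cat -!map_comp !map_id.
have W_gt0 : 0 < #|W|.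
  by have /card_gt0P[v _] := vertex_gt0 c; apply/card_gt0P; exists (g v).
have fiberE a b : f a = f b -> connect (adj (r ++ u)) a b.
  move=> /eqP; rewrite -uP; apply: sub_connect_adj => e.
  by rewrite mem_cat orbC => ->.
have l_conn : connected (unlabel l).
  rewrite lE; apply/forallP=> a; apply/forallP=> b.
  (* Move inside the fibre to its representative, follow a lifted path of [c], then move inside the
     last fibre. *)
  apply: (@connect_trans _ _ (g (f a))); first by rewrite fiberE ?gK.
  apply: (@connect_trans _ _ (g (f b))); last by rewrite fiberE ?gK.
  have := edges_connected c => /forallP/(_ (f a))/forallP/(_ (f b)).
  apply: connect_homo => x y.
  have aux x' y' : (x', y') \in edges c ->
      connect (adj (r ++ u)) (g x') (g y').
    rewrite -rE => /mapP[[p q] pq [-> ->]] /=.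
    apply: (@connect_trans _ _ p); first by rewrite fiberE ?gK.
    apply: (@connect_trans _ _ q); last by rewrite fiberE ?gK.
    by apply/connect1/orP; left; rewrite mem_cat pq.
  by case/orP=> /aux //; rewrite connect_adj_sym.
pose G := LabelledGraph W_gt0 l_conn.
have redE : redges G = r.
  rewrite /redges /= filter_cat map_cat !filter_map /=.
  by rewrite filter_predT filter_pred0 -map_comp map_id cats0.
have vedE : vedges G = u.
  rewrite /vedges /= filter_cat map_cat !filter_map /=.
  by rewrite (@filter_pred0 _ r) (@filter_predT _ u) /= -map_comp map_id.
exists G; first by move=> w /=; rewrite lE.
have [h [h1 h2 h3]] := pi_map_collapse G.
(* Since [h] and [f] have the same fibres, [f] composed with any section of [h] is a bijection. *)
have {}h2 a b : (h a == h b) = (f a == f b) by rewrite h2 vedE uP.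
have h1' z : exists a, h a == z by have [a <-] := h1 z; exists a.
pose h' z := xchoose (h1' z).
have h'K : cancel h' h by move=> z; apply/eqP/(xchooseP (h1' z)).
have fh' a : f (h' (h a)) = f a by apply/eqP; rewrite -h2 h'K.
exists (f \o h'); split.
  exists (h \o g) => v /=; last by rewrite fh' gK.
  by rewrite -[RHS]h'K; apply/eqP; rewrite h2 gK.
have := perm_map (fun e => [set (f \o h') e.1; (f \o h') e.2]) h3.
move/perm_trans; apply; rewrite redE -rE -!map_comp.
by under eq_map => e do rewrite /= !fh'.
Qed.

(** * The blow-up of a boundary graph *)

Section Blowup.

Variable c : boundary_graph.

Let V := vertex c.
Let m := size (edges c).

(** Edge ends are indexed by position, which keeps parallel edges and the two ends of a loop apart.
    The extra points make every fibre non-empty, even over a vertex of valence 0. *)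
Definition blowup : finType := ((V * bool) + ('I_m * bool))%type.

Definition blowup_proj (w : blowup) : V :=
  match w with
  | inl p => p.1
  | inr p => let e := tnth (in_tuple (edges c)) p.1 in if p.2 then e.2 else e.1
  end.

Definition real_edges : seq (blowup * blowup) :=
  [seq (inr (k, false), inr (k, true)) | k <- enum 'I_m].

Definition extra_edges : seq (blowup * blowup) :=
  [seq (inl (v, false), inl (v, true)) | v <- enum V].

Definition fiber (v : V) : seq blowup := enum [pred w | blowup_proj w == v].

Definition fiberwise (F : seq blowup -> seq (blowup * blowup)) :=
  flatten [seq F (fiber v) | v <- enum V].

Lemma map_real_edges :
  [seq (blowup_proj e.1, blowup_proj e.2) | e <- real_edges] = edges c.
Proof.
rewrite -map_comp -[RHS](map_tnth_enum (in_tuple (edges c))).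
by apply: eq_map => k /=; case: (tnth _ k).
Qed.

Lemma valence_real_extra w : valence (real_edges ++ extra_edges) w = 1.
Proof.
rewrite valence_cat !valence_image /=; case: w => -[x b].
  rewrite big1 // add0n (bigD1 x) //= big1 => [|y /negPf yx].
    by case: b; rewrite /eq_op /= /eq_op /= !eqxx.
  by rewrite /eq_op /= /eq_op /= yx.
rewrite addnC big1 // add0n (bigD1 x) //= big1 => [|y /negPf yx].
  by case: b; rewrite /eq_op /= /eq_op /= !eqxx.
by rewrite /eq_op /= /eq_op /= yx.
Qed.

(** Every point is an end of exactly one real or extra edge, so counting points amounts to counting
    edge ends; the extra edge gives the 2. *)
Lemma size_fiber v : size (fiber v) = (valence (edges c) v).+2.
Proof.
rewrite -map_real_edges valence_map.
have extra : \sum_(w | blowup_proj w == v) valence extra_edges w = 2.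
  rewrite -valence_map -map_comp valence_image /=.
  by rewrite (bigD1 v) //= eqxx big1 // => x /negPf ->.
rewrite /fiber -cardE -sum1_card -addn2 -extra -big_split /=.
by apply: eq_bigr => w _; rewrite -valence_cat valence_real_extra.
Qed.

Lemma sum_count_fiber w : \sum_v count_mem w (fiber v) = 1.
Proof.
rewrite (bigD1 (blowup_proj w)) //= big1 => [|v vw].
  by rewrite addn0 count_uniq_mem ?enum_uniq // mem_enum inE eqxx.
by apply/count_memPn; rewrite mem_enum inE eq_sym.
Qed.

Lemma valence_fiberwise F k w :
  (forall v, valence (F (fiber v)) w = k * count_mem w (fiber v)) ->
  valence (fiberwise F) w = k.
Proof.
move=> FE; rewrite valence_flatten big_map big_enum /=.
by under eq_bigr do rewrite FE; rewrite -big_distrr /= sum_count_fiber muln1.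
Qed.

Lemma fiberwiseS F e :
  (forall s a, a \in F s -> a.1 \in s /\ a.2 \in s) ->
  e \in fiberwise F -> blowup_proj e.1 = blowup_proj e.2.
Proof.
move=> FS /flatten_mapP[v _ /FS[]].
by rewrite !mem_enum !inE => /eqP -> /eqP ->.
Qed.

(** Here [t] is a fibrewise virtual supplement of constant valence [n]; the real and extra edges add
    1 and the cycles [2(k+1)]. *)
Lemma blowup_exists k (t : seq (blowup * blowup)) :
  {in t, forall e, blowup_proj e.1 = blowup_proj e.2} ->
  forall n, (forall w, valence t w = n) ->
  exists2 G, lregular (n + (k.*2).+3) G & isomorphic (pi_map G) c.
Proof.
move=> tP n tn.
pose cyc := fiberwise (@cycle_edges blowup).
have cyc_val w : valence cyc w = 2.
  by apply: valence_fiberwise => v; rewrite valence_cycle mul2n.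
(* Taking [k.+1] copies leaves at least one cycle to connect each fibre. *)
have [cycs mem_cycs cycs_val] :
    exists2 s, s =i cyc & forall w, valence s w = k.+1.*2.
  exists (flatten (nseq k.+1 cyc)) => [e|w].
    apply/flattenP/idP => [[s /nseqP[-> _] //]|eC].
    by exists cyc; first exact: mem_head.
  by rewrite valence_flatten big_nseq cyc_val iter_addn_0 mul2n.
pose u := extra_edges ++ t ++ cycs.
apply: (@pi_map_blowup _ c _ blowup_proj (fun v => inl (v, false)) real_edges u).
- by [].
- move=> a b; apply/idP/eqP => [|ab].
    have uS e : e \in u -> blowup_proj e.1 = blowup_proj e.2.
      rewrite !mem_cat => /or3P[/mapP[v _ ->] //|/tP //|].
      by rewrite mem_cycs; apply: fiberwiseS; apply: cycle_edgesS.
    (* No virtual edge leaves a fibre. *)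
    have cl : closed (adj u) [pred w | blowup_proj a == blowup_proj w].
      by move=> x y /orP[] /uS /= xy; rewrite !inE xy.
    by move=> /(closed_connect cl); rewrite !inE eqxx => /esym/eqP.
  (* Conversely, the cycle through a fibre connects it. *)
  have : connect (adj (cycle_edges (fiber (blowup_proj b)))) a b.
    by apply: connect_cycle; rewrite mem_enum inE ?ab.
  apply: sub_connect_adj => e eC; rewrite !mem_cat mem_cycs.
  apply/or3P/Or33.
  by apply/flatten_mapP; exists (blowup_proj b); rewrite // mem_enum.
- exact: map_real_edges.
- move=> w; rewrite catA !valence_cat -valence_cat valence_real_extra.
  rewrite tn cycs_val; lia.
Qed.

End Blowup.

Theorem proposition2p32 (n : nat) (hn : 2 < n) :
  (odd n ->
     forall c : boundary_graph,
       exists2 G : labelled_graph, lregular n G & isomorphic (pi_map G) c)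
  /\
  (~~ odd n ->
     (forall G : labelled_graph, lregular n G -> even_valent (pi_map G))
     /\
     (forall c : boundary_graph, even_valent c ->
        exists2 G : labelled_graph, lregular n G & isomorphic (pi_map G) c)).
Proof.
split=> [on c|en].
  (* Solving [1 + 2(k+1) = n] gives [k = (n-3)/2], exact for odd [n > 2]. *)
  have -> : n = 0 + ((n - 3)./2.*2).+3 by lia.
  by apply: (@blowup_exists c _ [::]) => // w; rewrite valence_nil.
split=> [G|c ec]; first exact: even_valent_pi_map.
(* The matching adds 1, leaving [k = (n-4)/2]; an even [n > 2] is at least 4. *)
have -> : n = 1 + ((n - 4)./2.*2).+3 by lia.
apply: (@blowup_exists c _ (fiberwise (@matching_edges _))).
  by move=> e; apply: fiberwiseS; apply: matching_edgesS.
move=> w; apply: valence_fiberwise => v.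
(* A fibre has two points more than the valence of its vertex, so its size is even and the matching
   is perfect. *)
by rewrite mul1n valence_matching // size_fiber /= negbK ec.
Qed.
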